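(* For every PLTL formula $W$, the number $N$ of new proposition symbols introduced by the translation $\tau_0[W]$ into SNF satisfies $N\le 1+4\cdot\mathrm{len}(W)$.
   Context: PLTL formulae are built from proposition symbols, $\mathbf{true}$, $\mathbf{false}$, $\neg,\vee,\wedge,\Rightarrow$ and temporal operators $\bigcirc$ (next), $\Diamond$ (sometime), $\Box$ (always), $\mathcal{U}$ (until), $\mathcal{W}$ (unless); $\mathbf{start}$ is a nullary connective true only at the first moment. A literal is a proposition symbol or its negation. A PLTL-clause is a formula $\mathbf{start}\Rightarrow\bigvee_c l_c$, $\bigwedge_a k_a\Rightarrow\bigcirc\bigvee_d l_d$ or $\bigwedge_b k_b\Rightarrow\Diamond l$ with all $k,l$ literals. The translation: $\tau_0[A]=\Box(\mathbf{start}\Rightarrow y)\wedge\tau_1[\Box(y\Rightarrow A)]$ with $y$ a fresh proposition symbol, where $\tau_1$, applied to $\Box(x\Rightarrow W)$ ($x$ a proposition symbol), is computed by applying the following rewrite rules repeatedly until the result is a conjunction of formulae $\Box A_i$, each $A_i$ a PLTL-clause (write $\tau_1[x\Rightarrow A]$ for $\tau_1[\Box(x\Rightarrow A)]$; $y,z,v$ are proposition symbols new at each application; $l,m,l_i$ literals; $\neg\mathbf{true}$, $\neg\mathbf{false}$ rewritten to $\mathbf{false}$, $\mathbf{true}$). (1) $x\Rightarrow(A\wedge B)\mapsto\tau_1[x\Rightarrow A]\wedge\tau_1[x\Rightarrow B]$; $x\Rightarrow(A\Rightarrow B)\mapsto\tau_1[x\Rightarrow\neg A\vee B]$; $x\Rightarrow\neg(A\wedge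 B)\mapsto\tau_1[x\Rightarrow\neg A\vee\neg B]$; $x\Rightarrow\neg(A\Rightarrow B)\mapsto\tau_1[x\Rightarrow A]\wedge\tau_1[x\Rightarrow\neg B]$; $x\Rightarrow\neg(A\vee B)\mapsto\tau_1[x\Rightarrow\neg A]\wedge\tau_1[x\Rightarrow\neg B]$. (2) $x\Rightarrow\bigcirc A\mapsto\Box(x\Rightarrow\bigcirc y)\wedge\tau_1[y\Rightarrow A]$ if $A$ is neither a literal nor a disjunction of literals; $x\Rightarrow\neg\bigcirc A\mapsto\Box(x\Rightarrow\bigcirc y)\wedge\tau_1[y\Rightarrow\neg A]$; $x\Rightarrow\Box A\mapsto\tau_1[x\Rightarrow\Box y]\wedge\tau_1[y\Rightarrow A]$ ($A$ not a literal); $x\Rightarrow\neg\Box A\mapsto\Box(x\Rightarrow\Diamond y)\wedge\tau_1[y\Rightarrow\neg A]$; $x\Rightarrow\Diamond A\mapsto\Box(x\Rightarrow\Diamond y)\wedge\tau_1[y\Rightarrow A]$ ($A$ not a literal); $x\Rightarrow\neg\Diamond A\mapsto\tau_1[x\Rightarrow\Box y]\wedge\tau_1[y\Rightarrow\neg A]$; $x\Rightarrow A\,\mathcal{U}\,B\mapsto\tau_1[x\Rightarrow y\,\mathcal{U}\,B]\wedge\tau_1[y\Rightarrow A]$ ($A$ not a literal), $\mapsto\tau_1[x\Rightarrow A\,\mathcal{U}\,y]\wedge\tau_1[y\Rightarrow B]$ ($B$ not a literal); the same with $\mathcal{W}$ for $\mathcal{U}$; $x\Rightarrow\neg(A\,\mathcal{U}\,B)\mapsto\tau_1[x\Rightarrow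 y\,\mathcal{W}\,v]\wedge\tau_1[y\Rightarrow\neg B]\wedge\tau_1[v\Rightarrow(y\wedge z)]\wedge\tau_1[z\Rightarrow\neg A]$; $x\Rightarrow\neg(A\,\mathcal{W}\,B)\mapsto\tau_1[x\Rightarrow y\,\mathcal{U}\,v]\wedge\tau_1[y\Rightarrow\neg B]\wedge\tau_1[v\Rightarrow(y\wedge z)]\wedge\tau_1[z\Rightarrow\neg A]$. (3) $x\Rightarrow\Box l\mapsto\tau_1[x\Rightarrow l]\wedge\tau_1[x\Rightarrow y]\wedge\Box(y\Rightarrow\bigcirc l)\wedge\Box(y\Rightarrow\bigcirc y)$; $x\Rightarrow l\,\mathcal{U}\,m\mapsto\Box(x\Rightarrow\Diamond m)\wedge\tau_1[x\Rightarrow l\vee m]\wedge\tau_1[x\Rightarrow y\vee m]\wedge\Box(y\Rightarrow\bigcirc(l\vee m))\wedge\Box(y\Rightarrow\bigcirc(y\vee m))$; $x\Rightarrow l\,\mathcal{W}\,m\mapsto$ the same without $\Box(x\Rightarrow\Diamond m)$. (4) $x\Rightarrow D\vee A\mapsto\tau_1[x\Rightarrow D\vee y]\wedge\tau_1[y\Rightarrow A]$, $D$ a disjunction, $A$ neither a literal nor a disjunction of literals. (5) $x\Rightarrow D\mapsto\Box(\mathbf{start}\Rightarrow\neg x\vee D)\wedge\Box(\mathbf{true}\Rightarrow\bigcirc(\neg x\vee D))$ for $D$ a literal or disjunction of literals; $x\Rightarrow\mathbf{true}\mapsto\Box(\mathbf{start}\Rightarrow\mathbf{true})\wedge\Box(\mathbf{true}\Rightarrow\bigcirc\mathbf{true})$;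 $x\Rightarrow\mathbf{false}\mapsto\Box(\mathbf{start}\Rightarrow\neg x)\wedge\Box(\mathbf{true}\Rightarrow\bigcirc\neg x)$; $\tau_1[x\Rightarrow\Diamond l]=\Box(x\Rightarrow\Diamond l)$; $\tau_1[x\Rightarrow\bigcirc(l_1\vee\dots\vee l_n)]=\Box(x\Rightarrow\bigcirc(l_1\vee\dots\vee l_n))$. Length: $\mathrm{len}(\Diamond l)=1$; $\mathrm{len}(l_1\vee\dots\vee l_n)=1$ ($n\ge1$); $\mathrm{len}(c)=1$ for $c\in\{\mathbf{true},\neg\mathbf{true},\mathbf{false},\neg\mathbf{false}\}$; $\mathrm{len}(\bigcirc(l_1\vee\dots\vee l_n))=1$; $\mathrm{len}(\neg\Box A)=\mathrm{len}(\neg\Diamond A)=\mathrm{len}(\neg\bigcirc A)=1+\mathrm{len}(\neg A)$; $\mathrm{len}(\Box A)=1+\mathrm{len}(A)$; $\mathrm{len}(\Diamond A)=1+\mathrm{len}(A)$ ($A$ not a literal); $\mathrm{len}(\bigcirc A)=1+\mathrm{len}(A)$ ($A$ not a disjunction of literals); for $\circ\in\{\mathcal{U},\mathcal{W},\vee,\wedge\}$: $\mathrm{len}(\neg(A\circ B))=1+\mathrm{len}(\neg A)+\mathrm{len}(\neg B)$ and $\mathrm{len}(A\circ B)=1+\mathrm{len}(A)+\mathrm{len}(B)$ (for $\vee$: $A,B$ not disjunctions of literals); $\mathrm{len}(\neg(A\Rightarrow B))=1+\mathrm{len}(A)+\mathrm{len}(\neg B)$; $\mathrm{len}(A\Rightarrow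 B)=1+\mathrm{len}(\neg A)+\mathrm{len}(B)$. *)

(* Defs.v *)
From mathcomp Require Import all_boot.
Set Implicit Arguments. Unset Strict Implicit. Unset Printing Implicit Defensive.

(* Proposition symbols are natural numbers.  The nullary connective start is
   not a source-level connective: it occurs only as the antecedent of the
   clauses built by [Initial] below. *)
Inductive form : Type :=
| Var of nat
| Top
| Bot
| Not of form
| Or of form & form
| And of form & form
| Imp of form & form
| Next of form
| Sometime of form
| Always of form
| Until of form & form
| Unless of form & form.

Fixpoint vars (A : form) : seq nat :=
  match A with
  | Var p => [:: p]
  | Top | Bot => [::]
  | Not A | Next A | Sometime A | Always A => vars A
  | Or A B | And A B | Imp A B | Until A B | Unless A B => vars A ++ vars B
  end.

Definition is_literal (A : form) : bool :=
  match A with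
  | Var _ | Not (Var _) => true
  | _ => false
  end.

(* Disjunction of one or more literals, however bracketed. *)
Fixpoint is_ldisj (A : form) : bool :=
  match A with
  | Or A B => is_ldisj A && is_ldisj B
  | _ => is_literal A
  end.

Inductive clause : Type :=
| Initial of form                  (* start => D *)
| Step of seq form & form          (* /\K => next D; the empty /\ is true *)
| Eventuality of seq form & form.  (* /\K => sometime l *)

(* The constant true is accepted as a right-hand side because the translation
   of x => true produces start => true and true => next true. *)
Definition is_rhs (D : form) : bool :=
  match D with
  | Top => true
  | _ => is_ldisj D
  end.

Definition is_clause (C : clause) : bool :=
  match C with
  | Initial D => is_rhs D
  | Step K D => all is_literal K && is_rhs D
  | Eventuality K l => all is_literal K && is_literal l
  end.

(* A conjunct of an intermediate stage of the translation. *)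
Inductive item : Type :=
| Box of clause         (* always C *)
| Tau of nat & form.    (* tau_1[always (x => A)], still to be rewritten *)

(* [replace_disjunct A B E E'] : E is a disjunction having A as one of its
   disjuncts, i.e. E is D \/ A up to the order and bracketing of the other
   disjuncts, and E' is E with this occurrence of A replaced by B.  The
   disjuncts of E are the subformulae reached from the root of E through \/
   only; the root itself is excluded. *)
Inductive replace_disjunct (A B : form) : form -> form -> Prop :=
| RDleft D : replace_disjunct A B (Or A D) (Or B D)
| RDright D : replace_disjunct A B (Or D A) (Or D B)
| RDinleft E E' D : replace_disjunct A B E E' ->
    replace_disjunct A B (Or E D) (Or E' D)
| RDinright D E E' : replace_disjunct A B E E' ->
    replace_disjunct A B (Or D E) (Or D E').

(* [rule x A new r] : tau_1[always (x => A)] rewrites to the conjunction r by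
   one rule, whose new symbols are new.  That these are pairwise distinct and
   fresh is required in [reach].  [R_notnot] reads ~ ~ A as A; it is needed
   because pushing negations inwards creates double negations. *)
Inductive rule (x : nat) : form -> seq nat -> seq item -> Prop :=
| R_and A B : rule x (And A B) [::] [:: Tau x A; Tau x B]
| R_imp A B : rule x (Imp A B) [::] [:: Tau x (Or (Not A) B)]
| R_nand A B : rule x (Not (And A B)) [::] [:: Tau x (Or (Not A) (Not B))]
| R_nimp A B : rule x (Not (Imp A B)) [::] [:: Tau x A; Tau x (Not B)]
| R_nor A B : rule x (Not (Or A B)) [::] [:: Tau x (Not A); Tau x (Not B)]
| R_notnot A : rule x (Not (Not A)) [::] [:: Tau x A]
| R_ntop : rule x (Not Top) [::] [:: Tau x Bot]
| R_nbot : rule x (Not Bot) [::] [:: Tau x Top]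
| R_next A y : ~~ is_ldisj A ->
    rule x (Next A) [:: y] [:: Box (Step [:: Var x] (Var y)); Tau y A]
| R_nnext A y :
    rule x (Not (Next A)) [:: y]
      [:: Box (Step [:: Var x] (Var y)); Tau y (Not A)]
| R_always A y : ~~ is_literal A ->
    rule x (Always A) [:: y] [:: Tau x (Always (Var y)); Tau y A]
| R_nalways A y :
    rule x (Not (Always A)) [:: y]
      [:: Box (Eventuality [:: Var x] (Var y)); Tau y (Not A)]
| R_sometime A y : ~~ is_literal A ->
    rule x (Sometime A) [:: y]
      [:: Box (Eventuality [:: Var x] (Var y)); Tau y A]
| R_nsometime A y :
    rule x (Not (Sometime A)) [:: y]
      [:: Tau x (Always (Var y)); Tau y (Not A)]
| R_until_l A B y : ~~ is_literal A ->
    rule x (Until A B) [:: y] [:: Tau x (Until (Var y) B); Tau y A]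
| R_until_r A B y : ~~ is_literal B ->
    rule x (Until A B) [:: y] [:: Tau x (Until A (Var y)); Tau y B]
| R_unless_l A B y : ~~ is_literal A ->
    rule x (Unless A B) [:: y] [:: Tau x (Unless (Var y) B); Tau y A]
| R_unless_r A B y : ~~ is_literal B ->
    rule x (Unless A B) [:: y] [:: Tau x (Unless A (Var y)); Tau y B]
| R_nuntil A B y z v :
    rule x (Not (Until A B)) [:: y; z; v]
      [:: Tau x (Unless (Var y) (Var v)); Tau y (Not B);
          Tau v (And (Var y) (Var z)); Tau z (Not A)]
| R_nunless A B y z v :
    rule x (Not (Unless A B)) [:: y; z; v]
      [:: Tau x (Until (Var y) (Var v)); Tau y (Not B);
          Tau v (And (Var y) (Var z)); Tau z (Not A)]
| R_always_lit l y : is_literal l ->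
    rule x (Always l) [:: y]
      [:: Tau x l; Tau x (Var y);
          Box (Step [:: Var y] l); Box (Step [:: Var y] (Var y))]
| R_until_lit l m y : is_literal l -> is_literal m ->
    rule x (Until l m) [:: y]
      [:: Box (Eventuality [:: Var x] m);
          Tau x (Or l m); Tau x (Or (Var y) m);
          Box (Step [:: Var y] (Or l m));
          Box (Step [:: Var y] (Or (Var y) m))]
| R_unless_lit l m y : is_literal l -> is_literal m ->
    rule x (Unless l m) [:: y]
      [:: Tau x (Or l m); Tau x (Or (Var y) m);
          Box (Step [:: Var y] (Or l m));
          Box (Step [:: Var y] (Or (Var y) m))]
| R_or E E' A y : ~~ is_ldisj A -> replace_disjunct A (Var y) E E' ->
    rule x E [:: y] [:: Tau x E'; Tau y A]
| R_ldisj D : is_ldisj D ->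
    rule x D [::]
      [:: Box (Initial (Or (Not (Var x)) D));
          Box (Step [::] (Or (Not (Var x)) D))]
| R_top : rule x Top [::] [:: Box (Initial Top); Box (Step [::] Top)]
| R_bot :
    rule x Bot [::]
      [:: Box (Initial (Not (Var x))); Box (Step [::] (Not (Var x)))]
| R_sometime_lit l : is_literal l ->
    rule x (Sometime l) [::] [:: Box (Eventuality [:: Var x] l)]
| R_next_ldisj D : is_ldisj D ->
    rule x (Next D) [::] [:: Box (Step [:: Var x] D)].

(* [reach W s new] : the conjunction s is an intermediate stage of the
   computation of tau_0[W], and new lists the symbols introduced so far.
   Conjuncts may be rewritten in any order and by any applicable rule. *)
Inductive reach (W : form) : seq item -> seq nat -> Prop :=
| Reach_tau0 y : y \notin vars W ->
    reach W [:: Box (Initial (Var y)); Tau y W] [:: y]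
| Reach_rule s1 x A s2 used new r :
    reach W (s1 ++ Tau x A :: s2) used ->
    rule x A new r ->
    uniq (new ++ used) -> all (fun y => y \notin vars W) new ->
    reach W (s1 ++ r ++ s2) (new ++ used).

Definition tau0 (W : form) (cs : seq clause) (new : seq nat) : Prop :=
  reach W [seq Box C | C <- cs] new /\ all is_clause cs.

(* [len_sign false A] is len(A) and [len_sign true A] is len(~ A); carrying
   the sign makes the recursion structural.  A doubly negated formula has the
   length of the formula. *)
Fixpoint len_sign (neg : bool) (A : form) : nat :=
  match A with
  | Var _ | Top | Bot => 1
  | Not A => len_sign (~~ neg) A
  | Or A B =>
      if ~~ neg && is_ldisj (Or A B) then 1
      else 1 + len_sign neg A + len_sign neg B
  | And A B | Until A B | Unless A B =>
      1 + len_sign neg A + len_sign neg B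
  | Imp A B => 1 + len_sign (~~ neg) A + len_sign neg B
  | Next A =>
      if ~~ neg && is_ldisj A then 1 else 1 + len_sign neg A
  | Sometime A =>
      if ~~ neg && is_literal A then 1 else 1 + len_sign neg A
  | Always A => 1 + len_sign neg A
  end.

Definition len (A : form) : nat := len_sign false A.

(* Main.v *)
(* Bound the symbols still to be introduced by a potential [cost] of the
   pending conjuncts.  The potential counts one symbol for each subformula that
   must be named, plus those consumed by the connective itself (at most 4, for
   a negated until or unless), so no rule, in whatever order the rules are
   applied, increases (symbols introduced) + (potential).  Finally the
   potential of [W] is at most [4 * len W]. *)
Require Import Defs.
From mathcomp Require Import all_boot zify.
Set Implicit Arguments. Unset Strict Implicit. Unset Printing Implicit Defensive.

(** An operand that cannot stay in place is charged one symbol to name it, and its own cost then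
    falls due. *)
Definition naming_cost (simple : bool) (c : nat) : nat :=
  if simple then 0 else c.+1.

(* As for [len_sign], [cost false A] is the potential of A and [cost true A]
   that of ~ A. *)
Fixpoint cost (neg : bool) (A : form) : nat :=
  match A with
  | Var _ | Top | Bot => 0
  | Not A => cost (~~ neg) A
  | Or A B =>
      if neg then cost true A + cost true B
      else naming_cost (is_ldisj A) (cost false A)
           + naming_cost (is_ldisj B) (cost false B)
  | And A B =>
      if neg then naming_cost (is_ldisj (Not A)) (cost true A)
                  + naming_cost (is_ldisj (Not B)) (cost true B)
      else cost false A + cost false B
  | Imp A B =>
      if neg then cost false A + cost true B
      else naming_cost (is_ldisj (Not A)) (cost true A)
           + naming_cost (is_ldisj B) (cost false B)
  | Next A =>
      if neg then 1 + cost true A else naming_cost (is_ldisj A) (cost false A)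
  | Sometime A =>
      if neg then 2 + cost true A else naming_cost (is_literal A) (cost false A)
  | Always A =>
      if neg then 1 + cost true A
      else 1 + naming_cost (is_literal A) (cost false A)
  | Until A B | Unless A B =>
      if neg then 4 + cost true A + cost true B
      else 1 + naming_cost (is_literal A) (cost false A)
           + naming_cost (is_literal B) (cost false B)
  end.

Definition item_cost (i : item) : nat :=
  if i is Tau _ A then cost false A else 0.

Definition items_cost (s : seq item) : nat := sumn (map item_cost s).

Lemma items_cost_cat s1 s2 :
  items_cost (s1 ++ s2) = items_cost s1 + items_cost s2.
Proof. by rewrite /items_cost map_cat sumn_cat. Qed.

Lemma naming_cost_le b c : naming_cost b c <= c.+1.
Proof. by case: b. Qed.

Lemma literal_ldisj l : is_literal l -> is_ldisj l.
Proof. by case: l. Qed.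

Lemma cost_ldisj D : is_ldisj D -> cost false D = 0.
Proof. by elim: D => //= [[]//|A _ B _ /andP[-> ->]]. Qed.

Lemma cost_literal l : is_literal l -> cost false l = 0.
Proof. by move/literal_ldisj/cost_ldisj. Qed.

Lemma replace_disjunct_nldisj A B E E' :
  replace_disjunct A B E E' -> ~~ is_ldisj A -> ~~ is_ldisj E.
Proof.
by move=> H nA; elim: H => [D|D|F F' D _ IH|D F F' _ IH] /=;
  rewrite negb_and ?nA ?IH ?orbT.
Qed.

(** The drop by one pays for [y]. Each nested disjunction around [A] contains a non-literal
    disjunct, so it is already charged as if it were to be named; replacing [A] can only remove that
    charge. *)
Lemma cost_replace_disjunct A y E E' :
  ~~ is_ldisj A -> replace_disjunct A (Var y) E E' ->
  (cost false E' + cost false A).+1 <= cost false E.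
Proof.
move=> nA; elim=> [D|D|F F' D RF IH|D F F' RF IH] /=.
- by rewrite (negbTE nA) /=; lia.
- by rewrite (negbTE nA) /=; lia.
- rewrite (negbTE (replace_disjunct_nldisj RF nA)) /=.
  by have := naming_cost_le (is_ldisj F') (cost false F'); lia.
- rewrite (negbTE (replace_disjunct_nldisj RF nA)) /=.
  by have := naming_cost_le (is_ldisj F') (cost false F'); lia.
Qed.

Lemma rule_cost x A new r :
  rule x A new r -> size new + items_cost r <= cost false A.
Proof.
(* The constants of [cost] balance here: a negated until or unless spends [y], [z], [v] and leaves
   an unless or until of literals, which owes one more; a negated sometime spends [y] and leaves an
   always that owes one. *)
case=> //; rewrite /items_cost /=; try lia.
- by move=> B y nB; rewrite (negbTE nB) /=; lia.
- by move=> B y nB; rewrite (negbTE nB) /=; lia.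
- by move=> B y nB; rewrite (negbTE nB) /=; lia.
- by move=> B C y nB; rewrite (negbTE nB) /=; lia.
- by move=> B C y nC; rewrite (negbTE nC) /=; lia.
- by move=> B C y nB; rewrite (negbTE nB) /=; lia.
- by move=> B C y nC; rewrite (negbTE nC) /=; lia.
- by move=> l y ll; rewrite (cost_literal ll); lia.
- by move=> l m y ll lm; rewrite !literal_ldisj //=; lia.
- by move=> l m y ll lm; rewrite !literal_ldisj //=; lia.
- by move=> E E' B y nB /(cost_replace_disjunct nB); lia.
Qed.

Lemma reach_cost W s new :
  reach W s new -> size new + items_cost s <= 1 + cost false W.
Proof.
elim=> [y _|s1 x A s2 used new' r _ IH /rule_cost le_r _ _].
  (* The 1 in the bound is the symbol that starts the translation. *)
  by rewrite /items_cost /=; lia.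
move: IH; rewrite size_cat !items_cost_cat /items_cost /= -/(items_cost s2).
by rewrite /items_cost in le_r *; lia.
Qed.

Lemma cost_le_len neg A : cost neg A <= 4 * len_sign neg A.
Proof.
elim: A neg => //= [A IHA B IHB|A IHA B IHB|A IHA B IHB
  |A IH|A IH|A IH|A IHA B IHB|A IHA B IHB] neg.
(* A disjunction of literals has length 1 whatever its size, so the bounds on its operands do not
   help; its cost is 0. *)
1: have [/andP[-> ->]|_] := boolP (is_ldisj A && is_ldisj B).
1: case: neg => //=; have := IHA true; have := IHB true; lia.
all: try (case: neg; have := IHA true; have := IHA false;
  have := IHB true; have := IHB false;
  rewrite /naming_cost /=; do ?[case: ifP => _]; lia).
all: by case: neg; have := IH true; have := IH false;
  rewrite /naming_cost /=; do ?[case: ifP => _]; lia.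
Qed.

Theorem theorem7 (W : form) (cs : seq clause) (new : seq nat) :
  tau0 W cs new -> size new <= 1 + 4 * len W.
Proof.
case=> /reach_cost le_new _; have := cost_le_len false W.
by rewrite /len; lia.
Qed.
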